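(* Let $(\Omega,\Sigma,\nu)$ be a complete probability space, let $X$ be a Banach space and let $\Gamma\subseteq X^*$ be a total linear subspace. Suppose $X$ has property $(\mathcal{D}')$. Then every $\Gamma$-integrable function $f:\Omega\to X$ is Pettis integrable.
   Context: All Banach spaces are real. A ''subspace'' of a Banach space means a norm-closed linear subspace; a ''linear subspace'' need not be closed. $w^*$ denotes the weak$^*$ topology on $X^*$. A set $\Gamma\subseteq X^*$ is total (over $X$) if for every $x\in X\setminus\{0\}$ there is $x^*\in\Gamma$ with $x^*(x)\neq 0$. Let $\Gamma\subseteq X^*$ be a total linear subspace. A function $f:\Omega\to X$ is $\Gamma$-scalarly integrable if the real-valued function $\langle x^*,f\rangle:\omega\mapsto x^*(f(\omega))$ is $\nu$-integrable for every $x^*\in\Gamma$. It is $\Gamma$-integrable if it is $\Gamma$-scalarly integrable and for every $A\in\Sigma$ there is an element $\int_A f\,d\nu\in X$ such that $x^*(\int_A f\,d\nu)=\int_A\langle x^*,f\rangle\,d\nu$ for all $x^*\in\Gamma$. Pettis integrability is $\Gamma$-integrability for $\Gamma=X^*$. $X$ has property $(\mathcal{D}')$ if every $w^*$-sequentially closed subspace of $X^*$ is $w^*$-closed. *)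

(* Defs.v *)
From HB Require Import structures.
From mathcomp Require Import all_boot all_order all_algebra.
From mathcomp Require Import all_classical all_reals all_analysis.

Set Implicit Arguments.
Unset Strict Implicit.
Unset Printing Implicit Defensive.

Import Order.TTheory GRing.Theory Num.Theory.
Import numFieldNormedType.Exports.

Local Open Scope classical_set_scope.
Local Open Scope ring_scope.

Definition dual_pred (R : realType) (X : normedModType R) : {pred X -> R^o} :=
  mem [set f : X -> R^o | linear f /\ continuous f].

(* The topological dual X^*, equipped below with the operator norm. *)
Record dual (R : realType) (X : normedModType R) := Dual {
  dual_val :> X -> R^o;
  dual_valP : dual_val \in @dual_pred R X }.

Section dual_normed_module.
Context {R : realType} {X : normedModType R}.

HB.instance Definition _ := [isSub for @dual_val R X].
HB.instance Definition _ := [Choice of dual X by <:].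

Lemma dual_submod_closed : submod_closed (@dual_pred R X).
Proof.
split.
  rewrite inE; split; last exact: cst_continuous.
  by move=> a x y; rewrite /= scaler0 addr0.
move=> a f g; rewrite !inE => -[lf cf] [lg cg]; split.
  move=> b x y; rewrite !fctE lf lg !scalerDr !scalerA [b * a]mulrC.
  by rewrite addrACA.
move=> x; apply: cvgD; last exact: cg.
by apply: cvgZl_tmp; exact: cf.
Qed.

HB.instance Definition _ :=
  GRing.isSubmodClosed.Build R (X -> R^o) (@dual_pred R X) dual_submod_closed.
HB.instance Definition _ := [SubChoice_isSubLmodule of dual X by <:].

Definition dual_norm (f : dual X) : R :=
  sup [set `|f x| | x in [set x : X | `|x| <= 1]].

Lemma dual_linear (f : dual X) : linear f.
Proof. by have := dual_valP f; rewrite inE => -[]. Qed.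

Lemma dual_continuous (f : dual X) : continuous f.
Proof. by have := dual_valP f; rewrite inE => -[]. Qed.

HB.instance Definition _ (f : dual X) :=
  GRing.isLinear.Build R X R^o _ (dual_val f) (@dual_linear f).

Let dual_has_sup (f : dual X) :
  has_sup [set `|f x| | x in [set x : X | `|x| <= 1]].
Proof.
split; first by exists `|f 0|, 0 => //=; rewrite normr0.
have /linear_bounded_continuous/bounded_funP/(_ 1)[M fM] :=
  @dual_continuous f.
by exists M => _ [x x1 <-]; exact: fM.
Qed.

Let dual_norm_ub (f : dual X) x : `|x| <= 1 -> `|f x| <= dual_norm f.
Proof. by move=> x1; apply: (sup_upper_bound (dual_has_sup f)); exists x. Qed.

Let dual_norm_le (f : dual X) M :
  (forall x, `|x| <= 1 -> `|f x| <= M) -> dual_norm f <= M.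
Proof.
move=> fM; apply: ge_sup; first exact: (dual_has_sup f).1.
by move=> _ [x x1 <-]; exact: fM.
Qed.

Lemma ler_dual_normD f g : dual_norm (f + g) <= dual_norm f + dual_norm g.
Proof.
apply: dual_norm_le => x x1.
by rewrite (le_trans (ler_normD _ _))// lerD// dual_norm_ub.
Qed.

Let dual_normZ_le a f : dual_norm (a *: f) <= `|a| * dual_norm f.
Proof.
apply: dual_norm_le => x x1.
by rewrite normrZ ler_wpM2l// dual_norm_ub.
Qed.

Lemma dual_normZ a f : dual_norm (a *: f) = `|a| * dual_norm f.
Proof.
apply/eqP; rewrite eq_le dual_normZ_le/=.
have [->|a0] := eqVneq a 0.
  rewrite normr0 mul0r; apply: le_trans (normr_ge0 _) (dual_norm_ub _ (x := 0) _).
  by rewrite normr0.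
rewrite -ler_pdivlMl ?normr_gt0// -normfV.
by rewrite -{1}[f](scalerK a0) dual_normZ_le.
Qed.

Lemma dual_norm_eq0 f : dual_norm f = 0 -> f = 0.
Proof.
move=> f0; apply/val_inj/funext => x /=.
have [->|x0] := eqVneq x 0; first by rewrite (linear0 f).
have nx : `|x| != 0 by rewrite normr_eq0.
have : `|f (`|x|^-1 *: x)| <= 0.
  by rewrite -f0 dual_norm_ub// normrZ normfV normr_id mulVf.
by rewrite normr_le0 linearZ scaler_eq0 invr_eq0 (negPf nx)/= => /eqP.
Qed.

HB.instance Definition _ := Lmodule_isNormed.Build R (dual X)
  ler_dual_normD dual_normZ dual_norm_eq0.

End dual_normed_module.

(* `weak_star X` has the same elements as `dual X`, whose own topology is the
   norm one: the weak* topology is the trace of pointwise convergence. *)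
Definition weak_star (R : realType) (X : normedModType R) : Type :=
  initial_topology (@dual_val R X : dual X -> {ptws X -> R^o}).

HB.instance Definition _ (R : realType) (X : normedModType R) :=
  Topological.copy (weak_star X)
    (initial_topology (@dual_val R X : dual X -> {ptws X -> R^o})).

Definition linear_subspace (R : realType) (E : lmodType R) (V : set E) :=
  V 0 /\ forall (a : R) x y, V x -> V y -> V (a *: x + y).

Definition closed_subspace (R : realType) (E : normedModType R) (V : set E) :=
  linear_subspace V /\ closed V.

Definition sequentially_closed (T : topologicalType) (V : set T) :=
  forall (u : nat -> T) (l : T),
    (forall n, V (u n)) -> u @ \oo --> l -> V l.

(* A subspace of a Banach space is by convention norm closed. *)
Definition property_D' (R : realType) (X : normedModType R) :=
  forall V : set (dual X), closed_subspace V ->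
    @sequentially_closed (weak_star X) V ->
    @closed (weak_star X) V.

Definition total_over (R : realType) (X : normedModType R) (G : set (dual X)) :=
  forall x : X, x != 0 -> exists2 x' : dual X, G x' & x' x != 0.

Section gamma_integrable.
Context {d : measure_display} {T : measurableType d} {R : realType}.
Variables (nu : {measure set T -> \bar R}) (X : normedModType R).
Implicit Types (G : set (dual X)) (f : T -> X).

Definition scalarly_integrable G f :=
  forall x' : dual X, G x' -> nu.-integrable setT (fun w => (x' (f w))%:E).

Definition gamma_integrable G f :=
  scalarly_integrable G f /\
  forall A, measurable A -> exists I : X, forall x' : dual X, G x' ->
    x' I = (\int[nu]_(w in A) x' (f w))%R.

Definition pettis_integrable f := gamma_integrable [set: dual X] f.

End gamma_integrable.

(* Main.v *)
(* The functionals in Gamma and more generally those [g] for which [g \o f] is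
   integrable with [g (I A) = \int_A g \o f] for all [A], where [I A] is the
   Gamma-integral of [f] over [A], form a linear subspace [V] of the dual.
   It is weak* sequentially closed: if [g_n] in [V] tends weak* to [g], then
   [g_n \o f] tends to [g \o f] pointwise while its integral over each [A] tends
   to [g (I A)], and by a gliding hump argument (in place of the
   Vitali-Hahn-Saks theorem) the sequence is Cauchy in L^1. By property (D') [V]
   is weak* closed; being total, it is everything. *)
Require Import Defs.
From mathcomp Require Import all_boot all_order all_algebra.
From mathcomp Require Import all_classical all_reals all_analysis.
From mathcomp Require Import measurable_realfun lra.

Set Implicit Arguments.
Unset Strict Implicit.
Unset Printing Implicit Defensive.

Import Order.TTheory GRing.Theory Num.Theory.
Import numFieldNormedType.Exports.

Local Open Scope classical_set_scope.
Local Open Scope ring_scope.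

(** * Splitting and tails of integrals *)

Lemma Rintegral_setID d (T : measurableType d) (R : realType)
    (mu : {measure set T -> \bar R}) (A D : set T) (f : T -> R) :
  measurable A -> measurable D -> mu.-integrable setT (EFin \o f) ->
  \int[mu]_(x in A) f x =
  \int[mu]_(x in A `&` D) f x + \int[mu]_(x in A `\` D) f x.
Proof.
move=> mA mD fi; rewrite -[in LHS](setUIDK A D) Rintegral_setU//.
- exact: measurableI.
- exact: measurableD.
- apply: integrableS fi => //; apply: measurableU; [exact: measurableI|exact: measurableD].
- by rewrite disj_set2E; apply/eqP; rewrite setDE setIACA setICr setI0.
Qed.

Lemma le_normr_Rintegral_subset d (T : measurableType d) (R : realType)
    (mu : {measure set T -> \bar R}) (A B : set T) (f : T -> R) :
  measurable A -> measurable B -> A `<=` B -> mu.-integrable setT (EFin \o f) ->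
  `|\int[mu]_(x in A) f x| <= \int[mu]_(x in B) `|f x|.
Proof.
move=> mA mB AB fi.
apply: (le_trans (le_normr_Rintegral mA (integrableS _ mA _ fi))) => //.
have nfi : mu.-integrable setT (EFin \o (fun x => `|f x|)) by exact: integrable_norm.
rewrite (Rintegral_setID mB mA nfi) (setIidr AB) lerDl.
by apply: Rintegral_ge0.
Qed.

(** On each of the pieces of [D] where [f >= 0] and where [f < 0] the sign is constant, so [A] can
    be the piece that carries the larger share of the integral of [|f|]. *)
Lemma exists_half_normr_Rintegral d (T : measurableType d) (R : realType)
    (mu : {measure set T -> \bar R}) (D : set T) (f : T -> R) :
  measurable D -> mu.-integrable setT (EFin \o f) ->
  exists A, [/\ measurable A, A `<=` D &
    \int[mu]_(x in D) `|f x| <= 2 * `|\int[mu]_(x in A) f x|].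
Proof.
move=> mD fi.
have mf : measurable_fun setT f by apply/measurable_EFinP; case/integrableP: fi.
pose P := [set x | 0 <= f x].
have mP : measurable P.
  by rewrite -[P]setTI; exact: measurable_fun_le (measurable_cst _) mf.
have nfi : mu.-integrable setT (EFin \o (fun x => `|f x|)) by exact: integrable_norm.
have eP : \int[mu]_(x in D `&` P) `|f x| = \int[mu]_(x in D `&` P) f x.
  by apply: eq_Rintegral => x /set_mem[_ /= fx]; rewrite ger0_norm.
have eN : \int[mu]_(x in D `\` P) `|f x| = - \int[mu]_(x in D `\` P) f x.
  rewrite -mulN1r -RintegralZl//; [|exact: measurableD|]; last first.
    by apply: integrableS fi => //; exact: measurableD.
  apply: eq_Rintegral => x /set_mem[_ /= /negP]; rewrite -ltNge => fx.
  by rewrite mulN1r ltr0_norm.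
rewrite (Rintegral_setID mD mP nfi) eP eN.
have [h|h] := leP (- \int[mu]_(x in D `\` P) f x) (\int[mu]_(x in D `&` P) f x).
  exists (D `&` P); split; [exact: measurableI|exact: subIsetl|].
  by have := ler_norm (\int[mu]_(x in D `&` P) f x); lra.
exists (D `\` P); split; [exact: measurableD|exact: subDsetl|].
by have := ler_norm (- \int[mu]_(x in D `\` P) f x); rewrite normrN; lra.
Qed.

(** The complements decrease to the empty set, so their measures tend to 0 because [mu] is finite;
    absolute continuity of the integral concludes. *)
Lemma exists_Rintegral_setC_lt d (T : measurableType d) (R : realType)
    (mu : {finite_measure set T -> \bar R}) (B : (set T)^nat) (f : T -> R) :
  (forall n, measurable (B n)) -> {homo B : m n / (m <= n)%N >-> m `<=` n} ->
  \bigcup_n B n = setT -> mu.-integrable setT (EFin \o f) ->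
  forall e, 0 < e -> exists N, forall n, (N <= n)%N ->
    \int[mu]_(x in ~` B n) `|f x| < e.
Proof.
move=> mB ndB BT fi e e0.
have [r [r0 fr]] := integral_normr_continuous fi e0.
have : (mu \o (fun n => ~` B n)) n @[n --> \oo] --> mu (\bigcap_n ~` B n).
  apply: nonincreasing_cvg_mu => //=.
  - by rewrite -ge0_fin_numE// fin_num_measure//; exact: measurableC.
  - by move=> n; exact: measurableC.
  - by apply: bigcapT_measurable => n; exact: measurableC.
  - by move=> m n mn; apply/subsetPset; apply: subsetC; exact: ndB.
rewrite -setC_bigcup BT setCT measure0 => B0.
have [N _ NB] : \forall n \near \oo, (mu (~` B n) < r%:E)%E.
  have := @open_ereal_lt' R 0%E r%:E; rewrite lte_fin => /(_ r0) h.
  exact: (B0 _ h).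
by exists N => n Nn; apply: fr; [exact: measurableC|exact: NB].
Qed.

Lemma strict_seq_ge_homo (j : nat -> nat) : (forall i, (j i < j i.+1)%N) ->
  (forall i, (i <= j i)%N) /\ {homo j : m n / (m <= n)%N}.
Proof.
move=> jS; split; last by apply: homo_leq => // [|i]; [exact: leq_trans|exact: ltnW].
by elim=> // i IH; exact: leq_ltn_trans IH (jS i).
Qed.

(** * The gliding hump argument *)

Section gliding_hump.
Context {d : measure_display} {T : measurableType d} {R : realType}.
Variable mu : {finite_measure set T -> \bar R}.

(* [B i] is the set where [`|h n| <= t / M] for all [n] beyond some index below
   [k i], so that [h (k i)] has most of its mass on [B i.+1 `\` B i]. *)
Lemma exists_gliding_hump (h : (T -> R)^nat) (e t : R) :
  (forall n, mu.-integrable setT (EFin \o h n)) ->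
  (forall x, h n x @[n --> \oo] --> 0) -> 0 < t ->
  (forall N, exists2 n, (N <= n)%N & e <= \int[mu]_x `|h n x|) ->
  exists k : nat -> nat, exists B : (set T)^nat,
   [/\ forall i, (i <= k i)%N, forall i, measurable (B i),
       {homo B : m n / (m <= n)%N >-> m `<=` n} &
       forall i, [/\ e <= \int[mu]_x `|h (k i) x|,
         \int[mu]_(x in B i) `|h (k i) x| <= t &
         \int[mu]_(x in ~` B i.+1) `|h (k i) x| <= t]].
Proof.
move=> hi h0 t0 hbig.
have mh n : measurable_fun setT (h n) by apply/measurable_EFinP; case/integrableP: (hi n).
have nhi n : mu.-integrable setT (EFin \o (fun x => `|h n x|)) by exact: integrable_norm.
(* The added 1 keeps [M] positive even when [mu] is zero; the constant [t / M] then has integral at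
   most [t] over every measurable set. *)
pose M := fine (mu setT) + 1.
have M0 : 0 < M by rewrite ltr_wpDl// fine_ge0// measure_ge0.
pose E j : set T := \bigcap_(k in [set k | (j <= k)%N]) [set x | `|h k x| <= t / M].
have mE j : measurable (E j).
  apply: bigcap_measurable => [|k _]; first by exists j => /=.
  rewrite -[X in measurable X]setTI.
  apply: measurable_fun_le => //; exact: measurableT_comp.
have ndE : {homo E : m n / (m <= n)%N >-> m `<=` n}.
  by move=> m n mn x Ex k /= nk; apply: Ex; exact: leq_trans nk.
have ET : \bigcup_n E n = setT.
  apply/seteqP; split=> // x _.
  have tM : 0 < t / M by rewrite divr_gt0.
  have [N _ NP] := @cvgr0_norm_le _ _ _ _ _ _ (h0 x) _ tM.
  by exists N => // k /= Nk; exact: NP.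
have Ele j k : (j <= k)%N -> \int[mu]_(x in E j) `|h k x| <= t.
  move=> jk; apply: (@le_trans _ _ (\int[mu]_(x in E j) (t / M))).
    apply: le_Rintegral => //.
    - exact: integrableS (nhi k).
    - by apply: (integrableS measurableT) => //; exact: finite_measure_integrable_cst.
    - by move=> x Ex; exact: Ex.
  rewrite Rintegral_cst// mulrAC ler_pdivrMr// ler_pM2l//.
  apply: (@le_trans _ _ (fine (mu setT))); last by rewrite lerDl.
  by rewrite fine_le ?fin_num_measure// le_measure ?inE.
have /choice[k kP] : forall j, exists k, [/\ (j <= k)%N & e <= \int[mu]_x `|h k x|].
  by move=> j; have [k ? ?] := hbig j; exists k.
have /choice[s sP] : forall j, exists s, (j < s)%N /\
    \int[mu]_(x in ~` E s) `|h (k j) x| <= t.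
  move=> j; have [N NP] := exists_Rintegral_setC_lt mE ndE ET (hi (k j)) t0.
  exists (maxn N j.+1); rewrite leq_maxr; split=> //.
  by apply/ltW/NP; exact: leq_maxl.
(* As [s j > j], the iterates increase strictly. With [j = J i], the function [h (k j)] is small on
   [E j] because [k j >= j], and has little mass outside [E (s j)], the next set of the sequence. *)
pose J i := iter i s 0%N.
have [Jge Jmono] : (forall i, (i <= J i)%N) /\ {homo J : m n / (m <= n)%N}.
  by apply: strict_seq_ge_homo => i; have [] := sP (J i).
exists (k \o J), (E \o J); split => //=.
- by move=> i; apply: leq_trans (Jge i) _; have [] := kP (J i).
- by move=> m n mn; apply: ndE; exact: Jmono.
- move=> i; split.
  + by have [] := kP (J i).
  + by apply: Ele; have [] := kP (J i).
  + by have [] := sP (J i).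
Qed.

(** Otherwise infinitely many [h n] have L^1 norm at least [e]. Humps are extracted on disjoint sets
    [D i], and [U] collects from each a part on which the integral does not cancel; the integrals
    over this single [U] then cannot tend to 0. *)
Lemma cvg_Rintegral_norm0 (h : (T -> R)^nat) :
  (forall n, mu.-integrable setT (EFin \o h n)) ->
  (forall x, h n x @[n --> \oo] --> 0) ->
  (forall A, measurable A -> \int[mu]_(x in A) h n x @[n --> \oo] --> 0) ->
  \int[mu]_x `|h n x| @[n --> \oo] --> 0.
Proof.
move=> hi h0 hA.
have nhi n : mu.-integrable setT (EFin \o (fun x => `|h n x|)) by exact: integrable_norm.
apply/cvgr0Pnorm_lt => e e0; apply: contrapT => hbig.
have {}hbig N : exists2 n, (N <= n)%N & e <= \int[mu]_x `|h n x|.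
  apply: contrapT => hN; apply: hbig; exists N => // n /= Nn.
  rewrite ltNge ger0_norm ?Rintegral_ge0//; apply/negP => en.
  by apply: hN; exists n.
(* With [t = e / 8] the hump on [D N] has mass at least [e - 2 * t = 6 * t], hence an integral over
   [A N] of absolute value at least [3 * t]. The two other pieces of [U] contribute at most [t] each
   and the integral over [U] is below [t] in absolute value, a contradiction. *)
have e8 : 0 < e / 8 by rewrite divr_gt0.
have [k [B [kge mB ndB kB]]] := exists_gliding_hump hi h0 e8 hbig.
pose D i := B i.+1 `\` B i.
have mD i : measurable (D i) by exact: measurableD.
have /choice[A AP] i := exists_half_normr_Rintegral (mD i) (hi (k i)).
have mA i : measurable (A i) by case: (AP i).
pose U := \bigcup_i A i.
have mU : measurable U by exact: bigcupT_measurable.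
(* The [D i] are pairwise disjoint since [B] is nondecreasing. *)
have UD i : U `&` D i = A i.
  have AD m : A m `<=` D m by case: (AP m).
  apply/seteqP; split=> [x [[m _ Amx] [Bx nBx]]|x Ax]; last first.
    by split; [exists i|exact: AD].
  have [Bmx nBmx] := AD _ _ Amx.
  have [mi|im|<-//] := ltngtP m i.
    by case: nBx; exact: ndB Bmx.
  by case: nBmx; exact: ndB Bx.
have [N _ NP] := @cvgr0_norm_lt _ _ _ _ _ _ (hA U mU) _ e8.
have Usmall := NP (k N) (kge N).
have [ke kt kt'] := kB N.
have mUB : measurable (U `\` B N) by exact: measurableD.
have splitU := Rintegral_setID mU (mB N) (hi (k N)).
have splitUB := Rintegral_setID mUB (mB N.+1) (hi (k N)).
rewrite (_ : (U `\` B N) `&` B N.+1 = A N) in splitUB; last first.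
  by rewrite -UD /D !setDE setIAC setIA.
have small1 := le_normr_Rintegral_subset (measurableI _ _ mU (mB N)) (mB N)
  (@subIsetr _ _ _) (hi (k N)).
have small2 := le_normr_Rintegral_subset (measurableD mUB (mB N.+1))
  (measurableC (mB N.+1)) (@subIsetr _ _ _) (hi (k N)).
have [_ _ AN] := AP N.
have splitT := Rintegral_setID measurableT (mB N) (nhi (k N)).
have splitC := Rintegral_setID (measurableC (mB N)) (mB N.+1) (nhi (k N)).
have subBC : ~` B N `\` B N.+1 = ~` B N.+1.
  by rewrite setDE -setCU (setUidr (ndB _ _ (leqnSn N))).
rewrite setTI setTD in splitT.
rewrite [~` B N `&` _]setIC -setDE -/(D N) subBC in splitC.
set a := \int[mu]_(x in A N) _ in AN splitUB.
set u := \int[mu]_(x in U) _ in Usmall splitU.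
set v := \int[mu]_(x in U `&` B N) _ in splitU small1.
set w := \int[mu]_(x in U `\` B N `\` B N.+1) _ in splitUB small2.
have aE : a = u - v - w by lra.
have := ler_normB (u - v) w; have := ler_normB u v; rewrite -aE => uv uvw.
lra.
Qed.

End gliding_hump.

(** * From setwise convergence of integrals to L^1 convergence *)

Section setwise_convergence.
Context {d : measure_display} {T : measurableType d} {R : realType}.
Variable mu : {finite_measure set T -> \bar R}.
Variables (f_ : (T -> R)^nat) (f : T -> R) (l : set T -> R).
Hypothesis f_i : forall n, mu.-integrable setT (EFin \o f_ n).
Hypothesis f_f : forall x, f_ n x @[n --> \oo] --> f x.
Hypothesis f_l : forall A, measurable A ->
  \int[mu]_(x in A) f_ n x @[n --> \oo] --> l A.

Let f_diff_i n m : mu.-integrable setT (EFin \o (fun x => f_ n x - f_ m x)).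
Proof. exact: integrableB (f_i n) (f_i m). Qed.

(** A failure yields index pairs [p n], both entries at least [n], whose differences stay large in
    L^1 yet tend to 0 pointwise and in integral over each measurable set. *)
Let cauchy_L1 (e : R) : 0 < e -> exists N, forall n m, (N <= n)%N -> (N <= m)%N ->
  \int[mu]_x `|f_ n x - f_ m x| < e.
Proof.
move=> e0; apply: contrapT => /forallNP ncauchy.
have /choice[p pP] N : exists p : nat * nat,
    [/\ (N <= p.1)%N, (N <= p.2)%N & e <= \int[mu]_x `|f_ p.1 x - f_ p.2 x|].
  apply: contrapT => /forallNP np; apply: (ncauchy N) => n m Nn Nm.
  by rewrite ltNge; apply/negP => le; apply: (np (n, m)).
have p1 : (p n).1 @[n --> \oo] --> \oo.
  by move=> S [N _ NS]; exists N => // n /= Nn; apply: NS;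
    apply: leq_trans Nn _; case: (pP n).
have p2 : (p n).2 @[n --> \oo] --> \oo.
  by move=> S [N _ NS]; exists N => // n /= Nn; apply: NS;
    apply: leq_trans Nn _; case: (pP n).
have : \int[mu]_x `|f_ (p n).1 x - f_ (p n).2 x| @[n --> \oo] --> 0.
  apply: cvg_Rintegral_norm0 => [n|x|A mA]; first exact: f_diff_i.
    rewrite -(subrr (f x)); apply: cvgB.
      exact: (cvg_comp (fun n => (p n).1) (f_^~ x) p1 (@f_f x)).
    exact: (cvg_comp (fun n => (p n).2) (f_^~ x) p2 (@f_f x)).
  rewrite -(subrr (l A)).
  under eq_fun => n.
    rewrite RintegralB//; last first.
    - exact: integrableS (f_i _).
    - exact: integrableS (f_i _).
    over.
  apply: cvgB.
    exact: (cvg_comp (fun n => (p n).1)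
      (fun n => \int[mu]_(x in A) f_ n x) p1 (@f_l A mA)).
  exact: (cvg_comp (fun n => (p n).2)
    (fun n => \int[mu]_(x in A) f_ n x) p2 (@f_l A mA)).
move=> /cvgr0Pnorm_lt/(_ _ e0)[N _ /(_ N (leqnn N))/=].
have [_ _ le] := pP N.
by rewrite ger0_norm ?Rintegral_ge0// ltNge le.
Qed.

Let mf_ n : measurable_fun setT (f_ n).
Proof. by apply/measurable_EFinP; case/integrableP: (f_i n). Qed.

Let mf : measurable_fun setT f.
Proof. by apply: (measurable_fun_cvg mf_) => x _; exact: f_f. Qed.

(** Fatou's lemma lets the second index of the Cauchy estimate go to infinity. The integral is
    extended-valued because the integrability of [f] is deduced from this bound. *)
Let cvg_L1 (e : R) : 0 < e -> exists N, forall n, (N <= n)%N ->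
  (\int[mu]_x `|f_ n x - f x|%:E <= e%:E)%E.
Proof.
move=> e0; have [N NP] := cauchy_L1 e0; exists N => n Nn.
(* The shift by [N] makes the Cauchy bound available for every [m]. *)
pose g m x := (`|f_ n x - f_ (m + N)%N x|%:E)%E.
have mg m : measurable_fun setT (g m).
  by apply/measurable_EFinP; apply: measurableT_comp => //; exact: measurable_funB.
have gcvg x : g m x @[m --> \oo] --> `|f_ n x - f x|%:E.
  apply: cvg_EFin; first exact: nearW.
  apply: cvg_norm; apply: cvgB; first exact: cvg_cst.
  by have := @f_f x; rewrite -(cvg_shiftn N).
have -> : (\int[mu]_x `|f_ n x - f x|%:E = \int[mu]_x limn_einf (g^~ x))%E.
  apply: eq_integral => x _.
  by rewrite (is_cvg_limn_einfE (cvgP _ (gcvg x))) (cvg_lim _ (gcvg x)).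
apply: (le_trans (fatou _ measurableT mg _)) => [m x _|]; first by rewrite lee_fin.
rewrite limn_einf_lim; apply: lime_le; first exact: is_cvg_einfs.
apply: nearW => m; apply: (@le_trans _ _ (\int[mu]_x g m x)%E).
  by apply: ereal_inf_lbound; exists m => /=.
rewrite -[leLHS]fineK; last first.
  apply: integrable_fin_num => //; exact: integrable_norm (f_diff_i n (m + N)%N).
rewrite lee_fin; apply/ltW/NP => //; exact: leq_addl.
Qed.

Let integrable_lim : mu.-integrable setT (EFin \o f).
Proof.
have [N /(_ N (leqnn N)) NP] := cvg_L1 ltr01.
have di : mu.-integrable setT (EFin \o (fun x => f_ N x - f x)).
  apply/integrableP; split; last exact: le_lt_trans NP (ltry _).
  by apply/measurable_EFinP; exact: measurable_funB.
have -> : EFin \o f = EFin \o (fun x => f_ N x - (f_ N x - f x)).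
  by apply/funext => x /=; congr EFin; lra.
exact: integrableB (f_i N) di.
Qed.

(** L^1 convergence makes the integrals over [A] converge to that of [f], and limits are unique. *)
Lemma setwise_cvg_Rintegral : mu.-integrable setT (EFin \o f) /\
  forall A, measurable A -> \int[mu]_(x in A) f x = l A.
Proof.
split=> // A mA.
apply: (@cvg_unique _ _ ((fun n => \int[mu]_(x in A) f_ n x) @ \oo)) => //;
  last exact: f_l.
apply/cvgrPdistC_le => e e0; have [N NP] := cvg_L1 e0.
exists N => // n /= Nn.
have fi : mu.-integrable setT (EFin \o (fun x => f_ n x - f x)).
  exact: integrableB (f_i n) integrable_lim.
rewrite -RintegralB//; [|exact: integrableS (f_i n)|exact: integrableS integrable_lim].
apply: (le_trans (le_normr_Rintegral_subset mA measurableT _ fi)) => //.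
rewrite -lee_fin; apply: le_trans (NP _ Nn).
rewrite /Rintegral fineK//; apply: integrable_fin_num => //.
exact: integrable_norm fi.
Qed.

End setwise_convergence.

(** * Weak* and norm topologies on the dual *)

Lemma dual_scaleDE (R : realType) (X : normedModType R) (a : R)
    (f g : dual X) (x : X) : (a *: f + g) x = a * f x + g x.
Proof. by []. Qed.

Lemma ler_norm_dual (R : realType) (X : normedModType R) (f : dual X) (x : X) :
  `|f x| <= `|f| * `|x|.
Proof.
have [->|x0] := eqVneq x 0; first by rewrite linear0 !normr0 mulr0.
have nx : 0 < `|x| by rewrite normr_gt0.
rewrite -ler_pdivrMr// -[X in _ / X]normr_id mulrC -normfV -normrZ -linearZ.
apply: sup_ubound; last first.
  by exists (`|x|^-1 *: x) => //=; rewrite normrZ normfV normr_id mulVf// gt_eqF.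
have /linear_bounded_continuous/bounded_funP/(_ 1)[M fM] := @dual_continuous _ _ f.
by exists M => _ [y y1 <-]; exact: fM.
Qed.

(** Stated for filters, since it serves both for sequences and for the filter built in
    [weak_star_closed_total]. *)
Lemma weak_star_cvgP (R : realType) (X : normedModType R)
    (F : set_system (weak_star X)) (f : weak_star X) : Filter F ->
  F --> f <-> forall x : X, (g : dual X) x @[g --> F] --> (f : dual X) x.
Proof.
move=> FF.
pose ev : weak_star X -> {ptws X -> R^o} := @dual_val R X.
have ev_cont : continuous ev := @initial_continuous _ _ _.
have evP := @pointwise_cvgP X R^o (ev @ F) (ev f) _.
split=> [Ff|Ff].
  by apply/evP; apply: cvg_trans (ev_cont f); exact: cvg_app.
move/evP : Ff => {}Ff A [_ [[U oU <-] Uf] UA].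
apply: (@filterS _ F _ _ _ UA).
by apply: Ff; exact: open_nbhs_nbhs.
Qed.

(** Norm convergence implies weak* convergence. This supplies the norm closedness that [property_D']
    asks of a subspace. *)
Lemma weak_star_seq_closed_closed (R : realType) (X : normedModType R)
    (V : set (dual X)) :
  @sequentially_closed (weak_star X) V -> closed V.
Proof.
move=> Vs f Vf.
have /choice[u uP] (n : nat) : exists g : dual X, V g /\ `|f - g| < n.+1%:R^-1.
  have n0 : 0 < n.+1%:R^-1 :> R by rewrite invr_gt0.
  have [g [Vg fg]] := Vf _ (nbhsx_ballx f _ n0).
  by exists g; split.
apply: (Vs u) => [n|]; first by case: (uP n).
apply/weak_star_cvgP => x.
apply: (@cvg_trans _ ((fun n => u n x) @ \oo)); first by [].
have u_f : u n @[n --> \oo] --> f.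
  apply/cvgrPdist_lt => e e0; near=> n.
  have [_ /lt_trans] := uP n; apply.
  by near: n; exact: near_infty_natSinv_lt (PosNum e0).
apply/cvgrPdist_le => e e0; near=> n.
apply: (@le_trans _ _ (`|f - u n| * `|x|)); first exact: (ler_norm_dual (f - u n)).
(* Adding 1 allows division by the factor even when [x = 0]. *)
rewrite (@le_trans _ _ (`|f - u n| * (`|x| + 1)))//; first by rewrite ler_wpM2l ?lerDl.
rewrite -ler_pdivlMr ?ltr_wpDl//.
near: n; apply: cvgr_dist_le u_f _ _.
by rewrite divr_gt0 ?ltr_wpDl.
Unshelve. all: by end_near. Qed.

(** * Weak* density of total subspaces *)

Lemma linear_subspaceZ (R : realType) (E : lmodType R) (V : set E) a x :
  linear_subspace V -> V x -> V (a *: x).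
Proof. by move=> [V0 VD] Vx; rewrite -[_ *: _]addr0; exact: VD. Qed.

(* Induction on [s]: if some [v0] in [V] has [v0 x = 1], replace [V] by its
   elements vanishing at [x], and [p] by [p - p x *: v0]. *)
Lemma exists_dual_agree (R : realType) (X : normedModType R) (s : seq X) :
  forall (V : set (dual X)) (p : dual X), linear_subspace V ->
  (forall x, (forall v : dual X, V v -> v x = 0) -> p x = 0) ->
  exists2 v : dual X, V v & {in s, forall x, v x = p x}.
Proof.
elim: s => [|x s IH] V p [V0 VD] Vp; first by exists 0.
have [Vx|/existsNP[w /not_implyP[Vw wx]]] :=
    pselect (forall v : dual X, V v -> v x = 0).
  have [v Vv vp] := IH V p (conj V0 VD) Vp.
  by exists v => // y; rewrite inE => /predU1P[->|/vp//]; rewrite (Vx v Vv) Vp.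
move/eqP : wx => wx; pose v0 : dual X := (w x)^-1 *: w.
have Vv0 : V v0 by exact: linear_subspaceZ.
have v0x : v0 x = 1 by exact: mulVf.
pose q : dual X := - p x *: v0 + p.
have qE y : q y = p y - p x * v0 y by rewrite addrC -mulNr.
have [||v [Vv vx] vq] := IH [set v : dual X | V v /\ v x = 0] q.
- split=> [//|a v v' [Vv vx] [Vv' v'x]]; split; first exact: VD.
  by rewrite dual_scaleDE vx v'x mulr0 addr0.
- move=> y qy.
  (* For [v] in [V], the functional [v - v x *: v0] lies in [V] and vanishes at [x], hence at [y].
     So all of [V] vanishes at [y - v0 y *: x], and [p] does too. *)
  have : p (- v0 y *: x + y) = 0.
    apply: Vp => v Vv; rewrite (dual_linear v).
    transitivity ((- v x *: v0 + v) y).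
      by rewrite dual_scaleDE -[_ *: _]/(- v0 y * v x) mulNr mulrC -mulNr.
    apply: qy; split; first exact: VD.
    by rewrite dual_scaleDE v0x mulr1 addNr.
  by rewrite (dual_linear p) qE => /eqP; rewrite -[_ *: _]/(- v0 y * p x) => /eqP; lra.
- exists (p x *: v0 + v) => [|y]; first exact: VD.
  rewrite dual_scaleDE.
  rewrite inE => /predU1P[->|/vq ->]; first by rewrite v0x vx mulr1 addr0.
  by rewrite qE addrC subrK.
Qed.

(** Totality leaves only 0 annihilated by [V], so by [exists_dual_agree] every functional is matched
    on any finite set of points by an element of [V]: it is a weak* limit of such elements. *)
Lemma weak_star_closed_total (R : realType) (X : normedModType R)
    (V : set (dual X)) :
  linear_subspace V -> total_over V -> @closed (weak_star X) V -> V = setT.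
Proof.
move=> Vlin Vtot Vcl; apply/seteqP; split=> // p _.
have Vp (x : X) : (forall v : dual X, V v -> v x = 0) -> p x = 0.
  move=> Vx; have [->|/Vtot[v Vv]] := eqVneq x 0; first exact: linear0.
  by rewrite Vx// eqxx.
(* The sets [agree s] generate a filter on [V] that tends weak* to [p]; this
   stands in for the Hahn-Banach theorem. *)
pose agree (s : seq X) : set (weak_star X) :=
  [set v : dual X | V v /\ {in s, forall x, v x = p x}].
pose F : set_system (weak_star X) := filter_from setT agree.
have FF : ProperFilter F.
  apply: filter_from_proper; last first.
    by move=> s _; have [v Vv vp] := exists_dual_agree s Vlin Vp; exists v.
  apply: filter_from_filter; first by exists [::].
  move=> s t _ _; exists (s ++ t) => // v [Vv vp].
  by split; split=> // x xs; apply: vp; rewrite mem_cat xs ?orbT.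
apply: (@closed_cvg _ (weak_star X) F _ id V Vcl _ p).
  by exists [::] => // v [].
apply/weak_star_cvgP => x A /nbhs_singleton Ax.
by exists [:: x] => // v [_ vp] /=; rewrite vp// mem_head.
Qed.

(** * Extension from [Gamma] to the whole dual *)

Theorem theorem3p2 (R : realType) (d : measure_display) (T : measurableType d)
    (nu : probability T R) (X : completeNormedModType R) (Gamma : set (dual X)) :
  measure_is_complete nu ->
  linear_subspace Gamma -> total_over Gamma -> property_D' X ->
  forall f : T -> X, gamma_integrable nu Gamma f -> pettis_integrable nu f.
Proof.
move=> _ _ Gtot XD f [fi fI].
(* One integral [I A] is fixed for each [A], independently of the functional, which makes [V] below
   a linear subspace; nonmeasurable sets get the default value 0. *)
have /choice[I IP] (A : set T) : exists I : X, measurable A ->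
    forall g : dual X, Gamma g -> g I = \int[nu]_(w in A) g (f w).
  by have [/fI[I ?]|nA] := pselect (measurable A); [exists I|exists 0].
pose V := [set g : dual X | nu.-integrable setT (fun w => (g (f w))%:E) /\
  forall A, measurable A -> g (I A) = \int[nu]_(w in A) g (f w)].
have GV : Gamma `<=` V by move=> g Gg; split=> [|A mA]; [exact: fi|exact: IP].
have Vlin : linear_subspace V.
  split.
    split; first exact: integrable0.
    by move=> A mA; rewrite Rintegral_cst// mul0r.
  move=> a g h [gi gI] [hi hI].
  have agi : nu.-integrable setT (EFin \o (fun w => a * g (f w))).
    exact: (integrableZl measurableT a gi).
  split; first exact: integrableD agi hi.
  move=> A mA; rewrite dual_scaleDE gI// hI//.
  rewrite -RintegralZl//; last exact: integrableS gi.
  by rewrite -RintegralD//; [exact: integrableS agi|exact: integrableS hi].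
have Vseq : @sequentially_closed (weak_star X) V.
  move=> g l gV /weak_star_cvgP gl.
  have gI A : measurable A ->
      \int[nu]_(w in A) (g n : dual X) (f w) @[n --> \oo] --> (l : dual X) (I A).
    move=> mA; apply: cvg_trans (gl (I A)).
    rewrite (_ : (fun n => _) = (fun n => (g n : dual X) (I A)))//.
    by apply/funext => n; have [_ ->] := gV n.
  have [li lI] := setwise_cvg_Rintegral (fun n => (gV n).1) (fun w => gl (f w)) gI.
  by split=> // A mA; rewrite lI.
have Vcl : closed_subspace V.
  by split=> //; exact: weak_star_seq_closed_closed.
have Vtot : total_over V by move=> x /Gtot[g /GV]; exists g.
have VT : V = setT := weak_star_closed_total Vlin Vtot (XD V Vcl Vseq).
have inV (g : dual X) : V g by rewrite VT.
split=> [g _|A mA]; first by case: (inV g).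
by exists (I A) => g _; have [_ ->] := inV g.
Qed.
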